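(* Let $G$ be a locally compact group with a local right action on a locally compact space $X$, defined on the open set $\Gamma\subseteq X\times G$. Let $f$ be a non-zero polynomial function in $C_c(X)$. Then there exist a compact subset $C$ of $X$ and an open subgroup $G_0$ of $G$ such that $C\cdot G_0=C$ (that is, $(x,q)\in\Gamma$ for all $x\in C$, $q\in G_0$, and $\{x\cdot q\mid x\in C,\ q\in G_0\}=C$) and such that $f$ belongs to a finite-dimensional subspace $F$ of $\mathcal F_C$ that is invariant under the action of $G_0$ (that is, $q\cdot g\in F$ for all $g\in F$ and $q\in G_0$). Here $\mathcal F_C$ denotes the space of functions in $C_c(X)$ with support contained in $C$.
   Context: Locally compact groups and spaces are Hausdorff. $e$ is the identity of $G$; a neighborhood of $e$ always means an open neighborhood. $C_c(X)$ is the space of continuous complex functions on $X$ with compact support; the support is the closure of the set where the function is non-zero. Local right action of $G$ on $X$: a continuous map $(x,p)\mapsto x\cdot p$ from an open subset $\Gamma\subseteq X\times G$ to $X$ such that (i) $(x,e)\in\Gamma$ and $x\cdot e=x$ for all $x\in X$; (ii) for $(x,p)\in\Gamma$ and $q\in G$: $(x,pq)\in\Gamma$ if and only if $(x\cdot p,q)\in\Gamma$, and in that case $x\cdot(pq)=(x\cdot p)\cdot q$. For $f\in C_c(X)$ and $p\in G$ define $(p\cdot f)(x)=f(x\cdot p)$ if $(x,p)\in\Gamma$ and $(p\cdot f)(x)=0$ otherwise. Let $V_f=\{p\in G\mid (x,p^{-1})\in\Gamma\text{ for all }x\text{ in the support of }f\}$; this is an open neighborhood of $e$, and $p\cdot f\in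 C_c(X)$ for $p\in V_f$. $f\in C_c(X)$ is polynomial if there are a neighborhood $V$ of $e$ with $V\subseteq V_f$ and a finite-dimensional subspace $F'$ of $C_c(X)$ with $v\cdot f\in F'$ for all $v\in V$. *)

(* Defs.v *)
From HB Require Import structures.
From mathcomp Require Import all_boot all_order all_algebra.
From mathcomp Require Import complex.
From mathcomp Require Import all_classical all_reals topology normedtype.

Set Implicit Arguments.
Unset Strict Implicit.
Unset Printing Implicit Defensive.

Import GRing.Theory numFieldNormedType.Exports.
Local Open Scope classical_set_scope.
Local Open Scope ring_scope.
Local Open Scope complex_scope.

HB.mixin Record Group_isTopologicalGroup G & Topological G & Group G := {
  mulg_continuous : continuous (fun x : G * G => (x.1 * x.2)%g) ;
  invg_continuous : continuous (fun x : G => x^-1%g) }.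

#[short(type="topologicalGroupType")]
HB.structure Definition TopologicalGroup :=
  {G of Topological G & Group G & Group_isTopologicalGroup G}.

(* The action is encoded as a total function [lact] of which only the values
   on [ldom] (the set Gamma) are meaningful. *)
Record local_right_action (X : topologicalType) (G : topologicalGroupType) :=
  LocalRightAction {
    ldom : set (X * G) ;
    lact : X -> G -> X ;
    ldom_open : open ldom ;
    lact_continuous : {within ldom, continuous (fun z : X * G => lact z.1 z.2)} ;
    ldom1 : forall x, ldom (x, 1%g) ;
    lact1 : forall x, lact x 1%g = x ;
    ldomM : forall x p q, ldom (x, p) ->
      (ldom (x, (p * q)%g) <-> ldom (lact x p, q)) ;
    lactM : forall x p q, ldom (x, p) -> ldom (x, (p * q)%g) ->
      lact x (p * q)%g = lact (lact x p) q }.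

Definition fin_dim_subspace (K : fieldType) (E : lmodType K) (F : set E) :=
  GRing.submod_closed [in F] /\
  exists (n : nat) (e : 'I_n -> E), (forall i, F (e i)) /\
    forall g, F g -> exists c : 'I_n -> K, g = \sum_(i < n) c i *: e i.

(* Complex functions are given the codomain [R[i]^o], i.e. the complex numbers
   as a normed space over themselves: [^o] is what provides the topology. *)
Definition supp (R : realType) (X : topologicalType) (f : X -> R[i]^o) : set X :=
  closure [set x | f x != 0].

Definition Cc (R : realType) (X : topologicalType) : set (X -> R[i]^o) :=
  [set f | continuous f /\ compact (supp f)].

Definition Cc_on (R : realType) (X : topologicalType) (C : set X) :
    set (X -> R[i]^o) :=
  [set f | Cc f /\ supp f `<=` C].

Definition translate (R : realType) (X : topologicalType)
    (G : topologicalGroupType) (a : local_right_action X G) (p : G)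
    (f : X -> R[i]^o) : X -> R[i]^o :=
  fun x => if (x, p) \in ldom a then f (lact a x p) else 0.

Definition translation_nbhd (R : realType) (X : topologicalType)
    (G : topologicalGroupType) (a : local_right_action X G)
    (f : X -> R[i]^o) : set G :=
  [set p | forall x, supp f x -> ldom a (x, p^-1%g)].

Definition polynomial_function (R : realType) (X : topologicalType)
    (G : topologicalGroupType) (a : local_right_action X G)
    (f : X -> R[i]^o) :=
  Cc f /\
  exists V : set G, [/\ open V, V 1%g, V `<=` translation_nbhd a f &
    exists F' : set (X -> R[i]^o), [/\ fin_dim_subspace F', F' `<=` @Cc R X &
      forall v, V v -> F' (translate a v f)]].

(* Main.v *)
Require Import Defs.
From mathcomp Require Import all_boot all_order all_algebra.
From mathcomp Require Import complex.
From mathcomp Require Import all_classical all_reals topology normedtype.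

Set Implicit Arguments.
Unset Strict Implicit.
Unset Printing Implicit Defensive.

Import GRing.Theory numFieldNormedType.Exports.
Local Open Scope classical_set_scope.
Local Open Scope ring_scope.
Local Open Scope complex_scope.

(** The subspace [F] is found by minimality. Among the finite-dimensional
    subspaces of [C_c(X)] that contain [v . f] for all [v] in some neighborhood
    of [e], let [F] have the smallest spanning family, and let [V] be an open
    neighborhood of [e] with [v . f] in [F] for [v] in [V]. Such an [F] cannot
    be cut down by shrinking the neighborhood, and this forces [v . F] to lie
    in [F] for every [v] in [V]: the [g] in [F] with [v . g] in [F] form a
    subspace, which contains [w . f] for all [w] so close to [e] that [v w]
    stays in [V], because [v . (w . f) = (v w) . f]
    ([polynomial_near_invariant]). That identity needs [w^-1] to act on the
    support of [f] ([translateM]), which is why polynomial functions are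
    tested on translates by elements of [V_f].

    Let [C] be the union of the supports of the functions in [F]; it is the
    union of finitely many of them, hence compact
    ([spanned_common_support]). For [v] close to [e], all of [C] can be
    moved by [v], and both [v] and [v^-1] preserve [F]. If [x] is in the
    support of [g] in [F], then [x . v] is in the support of [v^-1 . g], again a
    function in [F] ([supp_translateV]); so [C . v] is contained in [C].

    Finally [G0] is the set of all [q] such that both [q] and [q^-1] are
    defined on [C] and preserve [C] and [F]. It is a subgroup
    ([stabilizer_group]) which contains a neighborhood of [e]
    ([stabilizer_near]), so it is open. *)

(** * Subspaces given as sets of vectors *)

Definition spanned (K : fieldType) (E : lmodType K) (n : nat) (F : set E) :=
  exists e : 'I_n -> E, (forall i, F (e i)) /\
    forall g, F g -> exists c : 'I_n -> K, g = \sum_(i < n) c i *: e i.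

Section SetSubspaces.
Variables (K : fieldType) (E : lmodType K) (F : set E).

Lemma submod_closedP : GRing.submod_closed [in F] <->
  F 0 /\ forall c g h, F g -> F h -> F (c *: g + h).
Proof.
split=> [[F0 FD]|[F0 FD]]; split; first exact: set_mem.
- by move=> c g h Fg Fh; apply: set_mem; apply: FD; apply: mem_set.
- exact: mem_set.
- by move=> c g h /set_mem Fg /set_mem Fh; apply: mem_set; apply: FD.
Qed.

End SetSubspaces.

(** A subspace of largest dimension among those contained in [P] is all of
    [P]: adding the line of a missing vector would enlarge it. *)
Lemma vspace_of_set (K : fieldType) (vT : vectType K) (P : set vT) :
  GRing.submod_closed [in P] -> exists U : {vspace vT}, forall u, u \in U <-> P u.
Proof.
move=> /submod_closedP[P0 PD].
pose Q d := `[< exists U : {vspace vT},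
  \dim U = d /\ forall u, u \in U -> P u >].
have exQ : exists d, Q d.
  exists 0%N; apply/asboolP; exists 0%VS; rewrite dimv0; split=> // u.
  by rewrite memv0 => /eqP->.
have leQ d : Q d -> (d <= \dim {:vT})%N.
  by move=> /asboolP[U [<- _]]; apply: dimvS; apply: subvf.
case: (ex_maxnP exQ leQ) => d /asboolP[U [dimU UP]] maxd.
exists U => u; split; first exact: UP.
move=> Pu; suff : (\dim (U + <[u]>) <= \dim U)%N.
  move=> le_dim; have /eqP -> : (U == U + <[u]>)%VS.
    by rewrite eqEdim addvSl.
  by rewrite memvE addvSr.
rewrite dimU; apply: maxd; apply/asboolP; exists (U + <[u]>)%VS; split=> //.
move=> _ /memv_addP[w wU [_ /vlineP[c ->] ->]].
by rewrite addrC; apply: PD => //; apply: UP.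
Qed.

(** A smallest spanning family can thus serve as a substitute for the dimension.
    The coordinate vectors [c] with [\sum_i c i *: e i] in [P] form a proper
    subspace of [K^n], although [e] may be linearly dependent: if all [c]
    qualified, [P] would be [F]. A basis of that subspace is sent to a family
    spanning [P]. *)
Lemma proper_subspace_spanned (K : fieldType) (E : lmodType K) (n : nat)
    (F P : set E) :
  spanned n F -> GRing.submod_closed [in P] -> P `<=` F -> ~ F `<=` P ->
  exists2 m, (m < n)%N & spanned m P.
Proof.
move=> [e [Fe spanF]] Psub PF nFP; have /submod_closedP[P0 PD] := Psub.
pose L (c : 'rV[K]_n) := \sum_(i < n) c 0 i *: e i.
have LD b (c d : 'rV[K]_n) : L (b *: c + d) = b *: L c + L d.
  rewrite /L scaler_sumr -big_split; apply: eq_bigr => i _.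
  by rewrite !mxE scalerDl scalerA.
have L0 : L 0 = 0 by rewrite /L big1// => i _; rewrite mxE scale0r.
have [U UP] : exists U : {vspace 'rV[K]_n}, forall u, u \in U <-> P (L u).
  apply: (@vspace_of_set _ _ [set u | P (L u)]); apply/submod_closedP.
  by split=> [|b c d /= Pc Pd]; rewrite /= ?L0 ?LD//; apply: PD.
have LK (c : 'I_n -> K) : L (\row_i c i) = \sum_(i < n) c i *: e i.
  by apply: eq_bigr => i _; rewrite mxE.
have dim_full : \dim {: 'rV[K]_n} = n by rewrite dimvf /dim /= mul1n.
exists (\dim U).
  rewrite ltnNge; apply/negP => le_nU; apply: nFP => g /spanF[c ->].
  rewrite -LK; apply/UP; suff -> : U = fullv by rewrite memvf.
  by apply/eqP; rewrite eqEdim subvf dim_full.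
exists (fun i => L (vbasis U)`_i); split=> [i|g Pg].
  by apply/UP; apply: vbasis_mem; apply: mem_nth; rewrite size_tuple.
have [c gE] := spanF g (PF g Pg).
have cU : \row_i c i \in U by apply/UP; rewrite LK -gE.
exists (fun i => coord (vbasis U) i (\row_i c i)).
rewrite gE -LK {1}(coord_vbasis cU).
have Lsum (r : seq 'I_(\dim U)) (b : 'I_(\dim U) -> K) w :
    L (\sum_(i <- r) b i *: w i) = \sum_(i <- r) b i *: L (w i).
  elim: r => [|i r IHr]; first by rewrite !big_nil L0.
  by rewrite !big_cons LD IHr.
exact: Lsum.
Qed.

(** * Supports *)

Section Supports.
Variables (R : realType) (X : topologicalType).
Implicit Types (f g : X -> R[i]^o) (F : set (X -> R[i]^o)).

(** [C] is the union of the supports of a spanning family: this finite union is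
    closed, so it also contains the supports of the linear combinations. *)
Lemma spanned_common_support n F : spanned n F -> F `<=` @Cc R X ->
  exists2 C : set X, compact C &
    (forall g, F g -> supp g `<=` C) /\
    (forall x, C x -> exists2 g, F g & supp g x).
Proof.
move=> [e [Fe spanF]] FCc.
exists (\big[setU/set0]_(i < n) supp (e i)).
  by apply: bigsetU_compact => i _; have [] := FCc _ (Fe i).
rewrite -bigcup_seq; split=> [g Fg|x [i _ ex]]; last by exists (e i).
have [c gE] := spanF g Fg.
have Ccl : closed (\bigcup_(i in [set` index_enum 'I_n]) supp (e i)).
  by apply: closed_bigcup => // i _; apply: closed_closure.
rewrite [X in _ `<=` X](proj1 (closure_id _) Ccl).
apply: closure_subset => x /= gx.
have [i ex] : exists i, e i x != 0.
  apply: contrapT => /forallNP e0; move/negP: gx; apply.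
  rewrite gE fct_sumE big1// => i _.
  have /negP := e0 i; rewrite negbK => /eqP eix.
  by rewrite /GRing.scale /= eix scaler0.
by exists i; [rewrite /= mem_index_enum | apply: subset_closure].
Qed.

End Supports.

(** * Local actions and translates *)

Section Translates.
Variables (R : realType) (X : topologicalType) (G : topologicalGroupType).
Variable a : local_right_action X G.
Implicit Types (f g h : X -> R[i]^o) (p q v w : G).

Lemma ldomK x v : ldom a (x, v) -> ldom a (lact a x v, v^-1%g).
Proof.
by move=> xv; apply/(ldomM _ xv); rewrite mulgV; apply: ldom1.
Qed.

Lemma lactK x v : ldom a (x, v) -> lact a (lact a x v) v^-1%g = x.
Proof.
move=> xv; rewrite -lactM// ?mulgV ?lact1//; exact: ldom1.
Qed.

Lemma translateE v g x : ldom a (x, v) -> translate a v g x = g (lact a x v).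
Proof. by move=> xv; rewrite /translate mem_set. Qed.

Lemma translate_out v g x : ~ ldom a (x, v) -> translate a v g x = 0.
Proof. by move=> xv; rewrite /translate memNset. Qed.

Lemma translate1 g : translate a 1%g g = g.
Proof.
by apply/funext => x; rewrite translateE ?lact1//; apply: ldom1.
Qed.

Lemma translate_linear v (c : R[i]) g h :
  translate a v (c *: g + h) = c *: translate a v g + translate a v h.
Proof.
apply/funext => x; rewrite /translate.
rewrite -[RHS]/(c *: (if _ then _ else _) + (if _ then _ else _)).
by case: ifP => //; rewrite scaler0 addr0.
Qed.

Lemma translate0 v : translate a v (0 : X -> R[i]^o) = 0.
Proof. by apply/funext => x; rewrite /translate if_same. Qed.

(** The two sides can differ only at [x] with [(x, v)] outside the domain; if
    [g] were non-zero at [y = x . (v w)] for such an [x], then [y] would lie in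
    the support, so that one could return from [y] along [w^-1] to [x . v]. *)
Lemma translateM v w g : translation_nbhd a g w ->
  translate a v (translate a w g) = translate a (v * w)%g g.
Proof.
move=> gw; apply/funext => x.
have [xv|xv] := pselect (ldom a (x, v)).
  rewrite translateE//; have [xvw|xvw] := pselect (ldom a (x, (v * w)%g)).
    by rewrite !translateE//; [rewrite lactM | apply/(ldomM _ xv)].
  by rewrite !translate_out// => /(ldomM _ xv).
rewrite translate_out//; have [xvw|xvw] := pselect (ldom a (x, (v * w)%g)).
  rewrite translateE//; apply/esym/eqP; apply: contrapT => /negP gx.
  apply: xv; rewrite -(mulgK w v); apply/(ldomM _ xvw).
  by apply: gw; apply: subset_closure.
by rewrite translate_out.
Qed.

Lemma lact_cvg x v : ldom a (x, v) ->
  (fun y => lact a y v) @ x --> lact a x v.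
Proof.
move=> xv.
have := @lact_continuous _ _ a; rewrite continuous_open_subspace; last exact: ldom_open.
move=> /(_ (x, v) (mem_set xv)) cvg_act.
apply: (@cvg_comp _ _ _ (fun y => (y, v)) (fun z => lact a z.1 z.2)) cvg_act.
by apply: cvg_pair; [apply: cvg_id | apply: cvg_cst].
Qed.

Lemma ldom_near_l x v : ldom a (x, v) -> \forall y \near x, ldom a (y, v).
Proof.
move=> xv.
have pair_cvg : (fun y => (y, v)) @ x --> (x, v).
  by apply: cvg_pair; [apply: cvg_id | apply: cvg_cst].
by apply: pair_cvg; apply: open_nbhs_nbhs; split=> //; apply: ldom_open.
Qed.

(** If [g] is non-zero at [y], its translate by [v^-1] takes the same value at
    [y . v]; a point of the support is a limit of such points [y]. *)
Lemma supp_translateV x v g : ldom a (x, v) -> supp g x ->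
  supp (translate a v^-1%g g) (lact a x v).
Proof.
move=> xv gx N Nxv.
have Nact : \forall y \near x, N (lact a y v) by apply: (lact_cvg xv).
have [y [gy [Ny yv]]] := gx _ (filterI Nact (ldom_near_l xv)).
exists (lact a y v); split=> //=.
by rewrite translateE ?lactK//; apply: ldomK.
Qed.

(** The tube lemma along [C], started from [(x, e)] in the open domain. *)
Lemma compact_ldom_near (C : set X) : compact C ->
  \forall v \near (1%g : G), forall x, C x -> ldom a (x, v).
Proof.
move=> /compact_near_coveringP; apply=> x _.
have : nbhs (x, 1%g) (ldom a).
  by apply: open_nbhs_nbhs; split; [apply: ldom_open | apply: ldom1].
by apply: filterS => -[].
Qed.

End Translates.

(** * Neighborhoods in topological groups *)

Section TopologicalGroups.
Variable G : topologicalGroupType.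

Lemma near_mull (p : G) (A : set G) : nbhs p A ->
  \forall q \near (1%g : G), A (p * q)%g.
Proof.
move=> pA; have := @mulg_continuous G (p, 1%g); rewrite /continuous_at /= mulg1.
have pair_cvg : (fun q => (p, q)) @ (1%g : G) --> (p, 1%g : G).
  by apply: cvg_pair; [apply: cvg_cst | apply: cvg_id].
move=> /(cvg_comp _ _ pair_cvg); exact.
Qed.

Lemma near_mulVl (p : G) (A : set G) : nbhs 1%g A ->
  \forall q \near p, A (p^-1 * q)%g.
Proof.
move=> A1; have := @mulg_continuous G (p^-1%g, p).
rewrite /continuous_at /= mulVg.
have pair_cvg : (fun q => (p^-1%g, q)) @ p --> (p^-1%g, p).
  by apply: cvg_pair; [apply: cvg_cst | apply: cvg_id].
move=> /(cvg_comp _ _ pair_cvg); exact.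
Qed.

Lemma near_inv (A : set G) : nbhs 1%g A -> \forall q \near (1%g : G), A q^-1%g.
Proof. by move=> A1; apply: (@invg_continuous G 1%g); rewrite invg1. Qed.

(** For [p] in [H], all [q] close to [p] satisfy [p^-1 q] in [H]. *)
Lemma subgroup_open (H : set G) : group_closed [in H] -> nbhs 1%g H -> open H.
Proof.
move=> [H1 HB] nH; rewrite openE => p Hp.
apply: filterS (near_mulVl p nH) => q Hq.
suff : (p / (p^-1 * q)^-1)%g \in H.
  by move/set_mem; rewrite invgK mulVKg.
have HV : (p^-1 * q)^-1%g \in [in H].
  by rewrite -[X in X \in _]div1g; apply: HB => //; apply: mem_set.
by apply: HB; first exact: mem_set.
Qed.

End TopologicalGroups.

(** * Invariance *)

Section Invariance.
Variables (R : realType) (X : topologicalType) (G : topologicalGroupType).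
Variable a : local_right_action X G.
Implicit Types (f g h : X -> R[i]^o) (F : set (X -> R[i]^o)) (C : set X).

(** [F] is chosen with the smallest possible spanning family among the
    subspaces that contain all translates of [f] by a neighborhood of [e]. For
    [v] in the neighborhood of such an [F], the [g] in [F] with [v . g] in [F]
    form a subspace that still contains [w . f] for all [w] close to [e], because
    [v . (w . f) = (v w) . f]; by minimality it is [F]. *)
Lemma polynomial_near_invariant f : polynomial_function a f ->
  exists F, [/\ fin_dim_subspace F, F `<=` @Cc R X, F f &
    \forall v \near (1%g : G), forall g, F g -> F (translate a v g)].
Proof.
move=> [_ [V0 [V0open V01 V0f [F0 [[F0sub [n0 F0span]] F0Cc V0F0]]]]].
have nV0 : nbhs 1%g V0 by apply: open_nbhs_nbhs.
pose Q n := `[< exists F, [/\ GRing.submod_closed [in F], F `<=` @Cc R X,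
  spanned n F & \forall v \near (1%g : G), F (translate a v f)] >].
have exQ : exists n, Q n.
  by exists n0; apply/asboolP; exists F0; split=> //; apply: filterS nV0.
case: (ex_minnP exQ) => n /asboolP[F [Fsub FCc Fspan nF]] minn.
have /submod_closedP[F_0 FD] := Fsub.
exists F; split=> //; first by split=> //; exists n.
  by have := nbhs_singleton nF; rewrite translate1.
have : nbhs 1%g [set v | F (translate a v f)] := nF.
rewrite nbhsE => -[V [Vopen V1] VF].
apply: filterS (open_nbhs_nbhs (conj Vopen V1)) => v Vv.
pose P := [set g | F g /\ F (translate a v g)].
have Psub : GRing.submod_closed [in P].
  apply/submod_closedP; split=> [|c g h [Fg Fvg] [Fh Fvh]].
    by split=> //; rewrite translate0.
  by split; [apply: FD | rewrite translate_linear; apply: FD].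
have nP : \forall w \near (1%g : G), P (translate a w f).
  have nV : nbhs v V by apply: open_nbhs_nbhs.
  apply: filterS (filterI nV0 (filterI nF (near_mull nV))) => w [V0w [Fw Vvw]].
  by split=> //; rewrite translateM; [apply: VF | apply: V0f].
have PF : P `<=` F by move=> g [].
suff FP : F `<=` P by move=> g /FP[].
apply: contrapT => /(proper_subspace_spanned Fspan Psub PF)[m lt_mn Pspan].
suff /minn : Q m by rewrite leqNgt lt_mn.
by apply/asboolP; exists P; split=> // g /PF; apply: FCc.
Qed.

Definition stabilizes C F (q : G) :=
  (forall x, C x -> ldom a (x, q) /\ C (lact a x q)) /\
  (forall g, F g -> F (translate a q g)).

(** The condition on [q^-1] is imposed separately because it does not follow
    formally from the one on [q]: [q] might map [C] to a proper subset. *)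
Definition stabilizer C F : set G :=
  [set q | stabilizes C F q /\ stabilizes C F q^-1%g].

(** The assumption on [q^-1] is what [translateM] needs in order to rewrite
    [(p q) . g] as [p . (q . g)]. *)
Lemma stabilizesM C F p q : F `<=` @Cc_on R X C ->
  stabilizes C F p -> stabilizes C F q -> stabilizes C F q^-1%g ->
  stabilizes C F (p * q)%g.
Proof.
move=> FC [Cp Fp] [Cq Fq] [CVq _]; split=> [x Cx|g Fg].
  have [xp Cxp] := Cp x Cx; have [xpq Cxpq] := Cq _ Cxp.
  have xpqM : ldom a (x, (p * q)%g) by apply/(ldomM _ xp).
  by rewrite lactM.
rewrite -translateM; first by apply: Fp; apply: Fq.
by move=> x gx; apply: (CVq x _).1; apply: (FC g Fg).2.
Qed.

Lemma stabilizer_group C F : F `<=` @Cc_on R X C ->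
  group_closed [in stabilizer C F].
Proof.
move=> FC; split=> [|p q /set_mem[Sp SVp] /set_mem[Sq SVq]]; apply: mem_set.
  suff S1 : stabilizes C F 1%g by split; rewrite ?invg1.
  by split=> [x Cx|g Fg]; rewrite ?lact1 ?translate1//; split=> //; apply: ldom1.
by split; rewrite ?invgM; apply: stabilizesM => //; rewrite ?invgK.
Qed.

(** When [C] is the union of the supports of the functions in [F], a [v] close
    to [e] maps [C] into [C] because [v^-1] maps [F] into [F]. *)
Lemma stabilizer_near C F : compact C -> F `<=` @Cc_on R X C ->
  (forall x, C x -> exists2 g, F g & supp g x) ->
  (\forall v \near (1%g : G), forall g, F g -> F (translate a v g)) ->
  nbhs 1%g (stabilizer C F).
Proof.
move=> Ccompact FC Csupp nF.
have nC := compact_ldom_near a Ccompact.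
apply: filterS (filterI (filterI nC nF) (filterI (near_inv nC) (near_inv nF))).
move=> v [[Cv Fv] [CVv FVv]].
have stab w : (forall x, C x -> ldom a (x, w)) ->
    (forall g, F g -> F (translate a w g)) ->
    (forall g, F g -> F (translate a w^-1%g g)) -> stabilizes C F w.
  move=> Cw Fw FVw; split=> // x Cx; split; first exact: Cw.
  have [g Fg gx] := Csupp x Cx.
  by apply: (FC _ (FVw g Fg)).2; apply: supp_translateV => //; apply: Cw.
by split; apply: stab => //; rewrite invgK.
Qed.

End Invariance.

Theorem theorem3p15 (R : realType) (G : topologicalGroupType)
    (X : topologicalType)
    (G_hausdorff : hausdorff_space G) (G_lc : locally_compact [set: G])
    (X_hausdorff : hausdorff_space X) (X_lc : locally_compact [set: X])
    (a : local_right_action X G) (f : X -> R[i]^o)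
    (f_poly : polynomial_function a f) (f_neq0 : f <> 0) :
  exists (C : set X) (G0 : set G),
    [/\ compact C,
        open G0 /\ group_closed [in G0],
        (forall x q, C x -> G0 q -> ldom a (x, q)),
        [set lact a x q | x in C & q in G0] = C &
        exists F : set (X -> R[i]^o),
          [/\ fin_dim_subspace F, F `<=` @Cc_on R X C, F f &
              forall g q, F g -> G0 q -> F (translate a q g)]].
Proof.
have [F [Ffin FCc Ff nF]] := polynomial_near_invariant f_poly.
have [_ [n Fspan]] := Ffin.
have [C Ccompact [suppC Csupp]] := spanned_common_support Fspan FCc.
have FC : F `<=` @Cc_on R X C.
  by move=> g Fg; split; [apply: FCc | apply: suppC].
have G0group := stabilizer_group a FC.
exists C, (stabilizer a C F); split=> //.
- split=> //; apply: subgroup_open => //; exact: stabilizer_near.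
- by move=> x q Cx [[Cq _] _]; have [] := Cq x Cx.
- apply/seteqP; split=> [_ [x Cx [q [[Cq _] _] <-]]|x Cx].
    by have [] := Cq x Cx.
  by exists x => //; exists 1%g; rewrite ?lact1//; apply: set_mem; case: G0group.
- by exists F; split=> // g q Fg [[_ Fq] _]; apply: Fq.
Qed.
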